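(* Let $g(x)$ be the number of $i$-congruent numbers less than $x$ for $d=0$ with $a>b$, counted with repetition; that is, $g(x)$ is the number of triples $(a,b,c)$ of positive integers with $a>b$, $a^2+b^2=c^2$, $\gcd(b,c)=1$ and $\frac{ab}{2}<x$. Then, as $x\to\infty$, $$\frac{\sqrt{x}}{2}+O(1)<g(x)\le \frac{1}{2\sqrt[3]{4}}\,x^{2/3}+O\left(x^{5/9}\right).$$
   Context: A positive integer $n$ is called an $i$-congruent number if there exist positive integers $a,b,c$ and an integer $d$ with $0\le d<a$ such that $n=\frac{(a+d)b}{2}$, $(a-d)^2+b^2=c^2$ and $\gcd(b,c)=1$ (the area of a right trapezoid with parallel sides $a,d$, height $b$ and slanted side $c$). The case $d=0$ is that of right triangles with legs $a,b$ and hypotenuse $c$. If the same number $n$ arises from several such triangles with $a>b$, it is counted once for each of them. The displayed inequalities mean that there is a constant $C>0$ such that for all sufficiently large $x$ one has $\frac{\sqrt{x}}{2}-C<g(x)\le \frac{1}{2\sqrt[3]{4}}x^{2/3}+Cx^{5/9}$. *)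

(* Defs.v *)
From HB Require Import structures.
From mathcomp Require Import all_boot all_order all_algebra.
From mathcomp Require Import finmap.
From mathcomp Require Import all_classical all_reals all_analysis.
Set Implicit Arguments.
Unset Strict Implicit.
Unset Printing Implicit Defensive.
Import Order.TTheory GRing.Theory Num.Theory.
Local Open Scope classical_set_scope.
Local Open Scope ring_scope.

Definition primitive_triangles (R : realType) (x : R) : set (nat * nat * nat) :=
  [set t | let: (a, b, c) := t in
    [/\ [/\ (0 < a)%N, (0 < b)%N & (0 < c)%N],
        (b < a)%N,
        (a ^ 2 + b ^ 2 = c ^ 2)%N,
        coprime b c
      & (a * b)%:R / 2 < x]].

(* [fset_set] is [fset0] on infinite sets; this lemma rules that case out. *)
Lemma finite_primitive_triangles (R : realType) (x : R) :
  finite_set (primitive_triangles x).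
Proof.
have [N xN] : exists N : nat, x * 2 < N%:R.
  by exists (Num.bound `|x * 2|); apply: le_lt_trans (ler_norm _) (archi_boundP _).
apply: (@sub_finite_set _ _ ((`I_N `*` `I_N) `*` `I_(N + N))); last first.
  by do 2?apply: finite_setX; exact: finite_II.
move=> [[a b] c] [[a0 b0 c0] _ abc _]; rewrite ltr_pdivrMr// => abx.
have abN : (a * b < N)%N by rewrite -(ltr_nat R) (lt_trans abx).
have aN : (a < N)%N by apply: leq_ltn_trans abN; exact: leq_pmulr.
have bN : (b < N)%N by apply: leq_ltn_trans abN; exact: leq_pmull.
split => //=; apply: (@leq_ltn_trans (a + b)%N).
  by rewrite -leq_sqr -abc sqrnD leq_addr.
by rewrite -addSn leq_add// ltnW.
Qed.

Definition g (R : realType) (x : R) : nat :=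
  #|` fset_set (primitive_triangles x)|%fset.

(* Main.v *)
Require Import Defs.
From HB Require Import structures.
From mathcomp Require Import all_boot all_order all_algebra.
From mathcomp Require Import finmap.
From mathcomp Require Import all_classical all_reals all_analysis.
From mathcomp Require Import zify ring lra.
Import Order.TTheory GRing.Theory Num.Theory.
Local Open Scope classical_set_scope.
Local Open Scope ring_scope.
Set Implicit Arguments.
Unset Strict Implicit.
Unset Printing Implicit Defensive.

(** Both bounds come from counting lattice points. The triangles are
parametrized by coprime u > v > 0: when b is even,
   (a, b, c) = (u^2 - v^2, 2uv, u^2 + v^2)  with u, v of opposite parity,
and when b is odd,
   (a, b, c) = ((u^2 - v^2)/2, uv, (u^2 + v^2)/2)  with u, v both odd.
In both forms b < a means v < (sqrt 2 - 1) u. The area is uv(u^2 - v^2) in the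
first form and a quarter of this in the second.

Upper bound. Since b < a forces v < u/2, an area below x forces
u^3 v <= 16 x in both forms. The region 0 < v < u, u^3 v <= T^4 contains O(T^2)
lattice points although it has a cusp along the u-axis ([cusp_count_le]), so
that g(x) = O(sqrt x) ([g_le_sqrt]), which is stronger than the claim.

Lower bound. The area is less than u^3 v (resp. u^3 v / 4), so it is enough to
count the coprime points of
   v <= tau u,  u^3 v <= tau T^4,  with tau = (4/5)^4 < sqrt 2 - 1,
where tau T^4 is x for opposite parities and 4x for both odd. This region has
area tau T^2, and each of the four classes of (u, v) modulo 2 contains a quarter
of its points up to a lower order term ([region_count_le],
[region_count_ge]). Points whose coordinates are both divisible by an odd prime
p form a copy of the region with T/p in place of T, so the coprime points are at
least a proportion 1 - sum 1/p^2 > 0.788 of each class other than the even-even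
one ([region_count_sieve], [sum_inv_sqr_odd_prime]). For opposite parities put
tau T^4 = x; the odd-odd class then has sqrt 2 T in place of T, hence twice as
many points. In total there are almost
   (1/4 + 1/4 + 2/4) * 0.788 * tau T^2 = 0.3228 T^2
triangles, and sqrt x / 2 = 0.32 T^2 ([g_ge_sqrt]). The sharp constant in place
of 1/2 is about 0.531; this margin is what makes the crude sieve sufficient. *)

(** * The boundary curve of the region and its primitive *)

Section Height.
Variable R : realType.
Implicit Types T s t : R.

(** For t > 0 this is the minimum of t and T^4/t^3, so the region is
v <= tau * height T u. *)
Definition height T t : R := if t <= T then t else T ^+ 4 / t ^+ 3.

(** The primitive of [height T] that vanishes at 0; its limit at infinity,
T^2, is the area under the whole curve. *)
Definition heightint T t : R :=
  if t <= T then t ^+ 2 / 2 else T ^+ 2 - T ^+ 4 / (2 * t ^+ 2).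

Lemma height_le T t : 0 < T -> height T t <= T.
Proof.
move=> T0; rewrite /height; case: (leP t T) => // Tt.
have t0 : 0 < t by lra.
rewrite ler_pdivrMr ?exprn_gt0// exprS ler_pM2l//.
by rewrite lerXn2r ?nnegrE// ltW.
Qed.

Lemma height_ge0 T t : 0 < T -> 0 <= t -> 0 <= height T t.
Proof.
move=> T0 t0; rewrite /height; case: (leP t T) => // Tt.
by rewrite divr_ge0 ?exprn_ge0 // ltW.
Qed.

Lemma height_le_id T t : 0 < T -> height T t <= t.
Proof.
move=> T0; have := height_le t T0; rewrite /height; case: (leP t T) => // Tt; lra.
Qed.

Lemma height_expr3 T t : 0 < T -> 0 < t -> height T t * t ^+ 3 <= T ^+ 4.
Proof.
move=> T0 t0; rewrite /height; case: (leP t T) => Tt.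
  by rewrite -exprS lerXn2r ?nnegrE// ltW.
by rewrite divfK// expf_neq0// gt_eqF.
Qed.

(** Homogeneity: this is what turns the points divisible by d into a smaller
copy of the region. *)
Lemma height_div d T t : 0 < d -> height (T / d) (t / d) = height T t / d.
Proof.
move=> d0; rewrite /height ler_pM2r ?invr_gt0//; case: (leP t T) => // Tt.
have [->|t0] := eqVneq t 0; first by rewrite !mul0r !expr0n/= !invr0 !mulr0 mul0r.
by field; rewrite t0 gt_eqF.
Qed.

Lemma heightint_le T t : 0 < T -> 0 <= t -> heightint T t <= T ^+ 2.
Proof.
move=> T0 t0; rewrite /heightint; case: (leP t T) => Tt; first by nra.
rewrite lerBlDr lerDl divr_ge0 ?mulr_ge0 ?exprn_ge0 ?ler0n //; exact: ltW.
Qed.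

Lemma heightint_ge T t : 0 < T -> T < t ->
  T ^+ 2 - T ^+ 4 / (2 * t ^+ 2) <= heightint T t.
Proof. by move=> T0 Tt; rewrite /heightint (leNgt t T) Tt lexx. Qed.

Let ratio_bounds s t : 0 <= s -> 0 < t -> s <= t -> 0 <= s / t <= 1.
Proof.
by move=> s0 t0 st; rewrite ler_pdivrMr// mul1r st divr_ge0// ltW.
Qed.

(** On the decreasing part of the curve, the right endpoint rule for the
integral is too small; the exact error is
(t - s)^2 (T/s)^2 (T/t)^2 (1/2 + s/t), in which every ratio is at most 1. *)
Lemma heightint_tail T s t : 0 < T -> T <= s -> s <= t ->
  0 <= (T ^+ 2 - T ^+ 4 / (2 * t ^+ 2)) - (T ^+ 2 - T ^+ 4 / (2 * s ^+ 2))
       - (t - s) * (T ^+ 4 / t ^+ 3) <= 3 / 2 * (t - s) ^+ 2.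
Proof.
move=> T0 Ts st; have s0 : 0 < s by lra. have t0 : 0 < t by lra.
have -> : (T ^+ 2 - T ^+ 4 / (2 * t ^+ 2)) - (T ^+ 2 - T ^+ 4 / (2 * s ^+ 2))
       - (t - s) * (T ^+ 4 / t ^+ 3) =
  (t - s) ^+ 2 * ((T / s) ^+ 2 * (T / t) ^+ 2 * (1 / 2 + s / t)).
  by field; rewrite !gt_eqF.
have a01 : 0 <= T / s <= 1 by apply: ratio_bounds; lra.
have b01 : 0 <= T / t <= 1 by apply: ratio_bounds; lra.
have c01 : 0 <= s / t <= 1 by apply: ratio_bounds; lra.
move: (T / s) (T / t) (s / t) a01 b01 c01 => a b c a01 b01 c01.
have a2 : 0 <= a ^+ 2 <= 1 by nra.
have b2 : 0 <= b ^+ 2 <= 1 by nra.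
have ab : 0 <= a ^+ 2 * b ^+ 2 <= 1 by nra.
have abc : 0 <= a ^+ 2 * b ^+ 2 * (1 / 2 + c) <= 3 / 2 by nra.
have d0 : 0 <= (t - s) ^+ 2 by rewrite sqr_ge0.
nra.
Qed.

(** The height is Lipschitz, so the right endpoint rule has a quadratic error,
also across the corner of the curve at T. Negative s are allowed: the parity
sums below start from s = -1. *)
Lemma heightint_step T s t : 0 < T -> s <= t ->
  `|heightint T t - heightint T s - (t - s) * height T t| <= 3 * (t - s) ^+ 2.
Proof.
move=> T0 st; rewrite /heightint /height ler_norml.
case: (leP t T) => tT.
  rewrite (le_trans st tT); nra.
have t0 : 0 < t by lra.
case: (leP s T) => sT; last first.
  have := heightint_tail T0 (ltW sT) st; have := sqr_ge0 (t - s); lra.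
have := heightint_tail T0 (lexx T) (ltW tT).
have -> : T ^+ 4 / (2 * T ^+ 2) = T ^+ 2 / 2 by field; rewrite gt_eqF.
have : 0 <= T - T ^+ 4 / t ^+ 3 <= 3 * (t - T).
  have -> : T - T ^+ 4 / t ^+ 3 = (t - T) * ((T / t) * (1 + T / t + (T / t) ^+ 2)).
    by field; rewrite gt_eqF.
  have b01 : 0 <= T / t <= 1 by apply: ratio_bounds; lra.
  move: (T / t) b01 => b b01.
  have b2 : 0 <= b ^+ 2 <= 1 by nra.
  have b3 : 0 <= b * (1 + b + b ^+ 2) <= 3 by nra.
  nra.
move: (T ^+ 4 / t ^+ 3) (T ^+ 4 / (2 * t ^+ 2)) => H V HT VT.
have : 0 <= (T - s) * (T - H) <= 3 * ((T - s) * (t - T)) by nra.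
have : 0 <= (T - s) * (t - T) by nra.
have -> : T ^+ 2 - V - s ^+ 2 / 2 - (t - s) * H =
  (T ^+ 2 - V - (T ^+ 2 - T ^+ 2 / 2) - (t - T) * H) + (T - s) * (T - H) - (T - s) ^+ 2 / 2
  by field.
have -> : (t - s) ^+ 2 = (t - T) ^+ 2 + (T - s) ^+ 2 + 2 * ((T - s) * (t - T)) by ring.
have := sqr_ge0 (t - T); have := sqr_ge0 (T - s).
lra.
Qed.

(** The integral is compared with its Riemann sum of step 2, each term costing
a bounded error. The primitive is taken at the last u <= n in the parity class,
so that the induction changes it only when a term is added. *)
Lemma parity_sum T (a : bool) (n : nat) : 0 < T ->
  `| \sum_(1 <= u < n.+1 | odd u == a) 2 * height T u%:R
   - heightint T (if odd n == a then n%:R else n%:R - 1)| <= 12 * n%:R + 1.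
Proof.
move=> T0; elim: n => [|n IHn].
  rewrite big_geq// sub0r mulr0 add0r normrN /heightint.
  case: a => /=.
    case: (leP (-1) T) => ?; last lra.
    by rewrite ger0_norm; lra.
  by rewrite (ltW T0) expr0n/= mul0r normr0 add0r ler01.
rewrite big_mkcond big_nat_recr//= -big_mkcond/=.
move: IHn; set S := \sum_(1 <= u < n.+1 | _) _.
have -> : (n.+1%:R - 1 : R) = n%:R by rewrite -natr1 addrK.
case: (eqVneq (~~ odd n) a) => na; last first.
  have -> : odd n = a by clear -na; case: (odd n) a na => [] [].
  by rewrite eqxx addr0 -natr1 => IHn; lra.
have -> : (odd n == a) = false by rewrite -na; case: (odd n).
have := @heightint_step T (n%:R - 1) n.+1%:R T0.
have -> : (n.+1%:R - (n%:R - 1) : R) = 2 by rewrite -natr1; ring.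
have -> : (n%:R - 1 <= n.+1%:R :> R) by rewrite -natr1; lra.
move=> /(_ isT); rewrite -natr1 => st IHn; move: st IHn; rewrite !ler_norml; lra.
Qed.

Lemma parity_sum_le T a n : 0 < T ->
  \sum_(1 <= u < n.+1 | odd u == a) 2 * height T u%:R <= T ^+ 2 + (12 * n%:R + 1).
Proof.
move=> T0; case: n => [|n].
  by rewrite big_geq// mulr0 add0r addr_ge0 ?sqr_ge0.
have := parity_sum a n.+1 T0; rewrite ler_norml => /andP[_].
set W := heightint _ _ => SW.
have : W <= T ^+ 2.
  by apply: heightint_le => //; case: ifP => _ //; rewrite -natr1 addrK.
lra.
Qed.

Lemma parity_sum_ge T a n : 0 < T -> T + 1 < n%:R ->
  T ^+ 2 - T ^+ 4 / (2 * (n%:R - 1) ^+ 2) - (12 * n%:R + 1) <=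
  \sum_(1 <= u < n.+1 | odd u == a) 2 * height T u%:R.
Proof.
move=> T0 Tn.
have := parity_sum a n T0; rewrite ler_norml => /andP[+ _].
set W := heightint _ _ => SW.
suff : T ^+ 2 - T ^+ 4 / (2 * (n%:R - 1) ^+ 2) <= W by lra.
have T4 : 0 <= T ^+ 4 by rewrite exprn_ge0// ltW.
rewrite /W; case: ifP => _; last by apply: heightint_ge => //; lra.
apply: le_trans (heightint_ge T0 _); last lra.
rewrite lerB// ler_wpM2l// lef_pV2 ?posrE; last 2 first.
- by rewrite mulr_gt0// exprn_gt0//; lra.
- by rewrite mulr_gt0// exprn_gt0//; lra.
- by rewrite ler_pM2l// lerXn2r ?nnegrE//; lra.
Qed.

Let parity_interval (b : bool) (m : nat) :
  (\sum_(1 <= v < m.+1) (odd v == b) = (m + b)./2)%N.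
Proof.
elim: m => [|m IHm]; first by rewrite big_geq//; case: b.
by rewrite big_nat_recr//= IHm; case: b {IHm}; case: (odd m) (odd_double_half m); lia.
Qed.

Lemma column_count (b : bool) (w : R) (N : nat) : 0 <= w -> w < N%:R ->
  `|2 * (\sum_(1 <= v < N) ((odd v == b) && (v%:R <= w)%R))%N%:R - w| <= 2.
Proof.
move=> w0 wN; have /andP[tw wt] := truncn_itv w0.
set m := Num.truncn w in tw wt.
have mN : (m < N)%N by rewrite -(ltr_nat R); apply: le_lt_trans wN.
rewrite (@big_cat_nat _ _ _ m.+1)//= [X in (_ + X)%N]big_nat_cond [X in (_ + X)%N]big1 ; last first.
  move=> v /andP[/andP[mv _] _]; rewrite leNgt (lt_le_trans wt) ?andbF//.
  by rewrite ler_nat.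
rewrite (@eq_big_nat _ _ _ _ _ _ (fun v => odd v == b : nat)); last first.
  move=> v /andP[_ vm]; rewrite (le_trans _ tw) ?andbT//.
  by rewrite ler_nat.
rewrite parity_interval addn0.
have : ((m <= 2 * (m + b)./2 + 1) /\ (2 * (m + b)./2 <= m + 1))%N.
  by case: b; lia.
move: ((m + b)./2) => c [].
rewrite -!(ler_nat R) !addn1 -!natr1 natrM => cm mc; rewrite -natr1 in wt.
rewrite ler_norml; lra.
Qed.
End Height.

(** * Lattice points of the region in a parity class *)

Section Region.
Variable R : realType.
Implicit Types T : R.

(** 256/625 = (4/5)^4 is a fourth power just below sqrt 2 - 1, so that
x = (256/625) T^4 gives a rational multiple of T^2 for sqrt x. Cutting the cusp
at u <= 10 T makes the number of columns, hence the error term, linear in T;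
it loses about 1/200 of the area. *)
Definition in_region (a b : bool) T (u v : nat) : bool :=
  [&& odd u == a, odd v == b, u%:R <= 10 * T
    & v%:R <= 256 / 625 * height T u%:R].

Definition region_count a b T (N : nat) : nat :=
  (\sum_(1 <= u < N) \sum_(1 <= v < N) in_region a b T u v)%N.

Definition coprime_region_count a b T (N : nat) : nat :=
  (\sum_(1 <= u < N) \sum_(1 <= v < N) (in_region a b T u v && coprime u v))%N.

(** Each of the at most 10 T columns contributes a bounded error. *)
Lemma region_count_column a b T N : 0 < T -> 10 * T < N%:R ->
  let n := Num.truncn (10 * T) in
  `|4 * (region_count a b T N)%:R
    - 256 / 625 * \sum_(1 <= u < n.+1 | odd u == a) 2 * height T u%:R|
  <= 4 * n%:R.
Proof.
move=> T0 TN; set n := Num.truncn _; have T10 : 0 <= 10 * T by lra.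
have /andP[nT Tn] := truncn_itv T10; rewrite -/n in nT Tn.
have nN : (n < N)%N by rewrite -(ltr_nat R); apply: le_lt_trans TN.
rewrite /region_count (@big_cat_nat _ _ _ n.+1)//=.
rewrite [X in (_ + X)%N]big_nat_cond [X in (_ + X)%N]big1 ?addn0; last first.
  move=> u /andP[/andP[nu _] _]; apply: big1 => v _.
  rewrite /in_region [_ <= 10 * T]leNgt (lt_le_trans Tn) ?andbF// ler_nat//.
rewrite natr_sum mulr_sumr [in X in _ - X]mulr_sumr [in X in _ - X]big_mkcond/=.
rewrite -sumrB; apply: le_trans (ler_norm_sum _ _ _) _.
apply: (@le_trans _ _ (\sum_(1 <= u < n.+1) 4)); last first.
  by rewrite sumr_const_nat subn1 mulr_natr.
rewrite big_nat_cond [leRHS]big_nat_cond; apply: ler_sum => u /andP[/andP[u0 un] _].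
have h0 := @height_ge0 _ T u%:R T0 (ler0n _ _).
have hu := @height_le_id _ T u%:R T0.
have uT : u%:R <= 10 * T by apply: le_trans nT; rewrite ler_nat.
rewrite /in_region uT /=; case: (odd u == a) => /=; last first.
  by rewrite big1// mulr0 subr0 normr0.
have := @column_count R b (256 / 625 * height T u%:R) N.
set c := (\sum_(1 <= v < N) _)%N => cc.
have {cc} : `|2 * c%:R - 256 / 625 * height T u%:R| <= 2 by apply: cc; lra.
rewrite !ler_norml; lra.
Qed.

(** The bound holds for all T > 0, small ones included, because the sieve
applies it to T/p for all primes p up to 10 T. When 10 T < 1 no column is left,
and otherwise the constant errors are absorbed by the linear one. *)
Lemma region_count_le a b T N : 0 < T -> 10 * T < N%:R ->
  4 * (region_count a b T N)%:R <= 256 / 625 * T ^+ 2 + 170 * T.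
Proof.
move=> T0 TN; have := region_count_column a b T0 TN; cbv zeta.
have T10 : 0 <= 10 * T by lra.
have /andP[] := truncn_itv T10.
case: (Num.truncn (10 * T)) => [|n] nT _ /=.
  rewrite big_geq// !mulr0 subr0 normr_le0 => /eqP ->.
  by have := sqr_ge0 T; lra.
have := parity_sum_le a n.+1 T0.
have : (0 : R) <= n%:R by [].
rewrite -natr1 in nT *; rewrite ler_norml; lra.
Qed.

(** The missing 52/10000 bounds the area beyond the cut: the primitive is
taken at a point at least 9.9 T, and 1/(2 * 9.9^2) < 0.0052. *)
Lemma region_count_ge a b T N : 20 <= T -> 10 * T < N%:R ->
  256 / 625 * (9948 / 10000) * T ^+ 2 - 170 * T <= 4 * (region_count a b T N)%:R.
Proof.
move=> T20 TN; have T0 : 0 < T by lra.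
have := region_count_column a b T0 TN; cbv zeta.
have T10 : 0 <= 10 * T by lra.
have /andP[] := truncn_itv T10.
move: (Num.truncn (10 * T)) => n nT /=; rewrite -natr1 => Tn.
have Tn1 : T + 1 < n%:R by lra.
have := parity_sum_ge a T0 Tn1.
have : T ^+ 4 / (2 * (n%:R - 1) ^+ 2) <= 52 / 10000 * T ^+ 2.
  have n1 : 99 / 10 * T <= n%:R - 1 by lra.
  have n2 : (99 / 10 * T) ^+ 2 <= (n%:R - 1) ^+ 2 by rewrite lerXn2r ?nnegrE//; lra.
  rewrite ler_pdivrMr; last by apply: lt_le_trans (_ : 2 * (99 / 10 * T) ^+ 2 <= _); nra.
  rewrite exprMn in n2.
  have -> : T ^+ 4 = T ^+ 2 * T ^+ 2 by ring.
  have : 0 < T ^+ 2 by rewrite exprn_gt0.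
  move: (T ^+ 2) ((n%:R - 1) ^+ 2) n2 => A B; nra.
rewrite ler_norml; lra.
Qed.

(** * The sieve by odd primes *)

Lemma sum_dvdn (F : nat -> nat) p n : (0 < p)%N ->
  (\sum_(1 <= u < n.+1 | p %| u) F (u %/ p) = \sum_(1 <= w < (n %/ p).+1) F w)%N.
Proof.
move=> p0; elim: n => [|n IHn]; first by rewrite div0n !big_geq.
rewrite big_mkcond big_nat_recr//= -big_mkcond IHn divnS//.
by case: (p %| n.+1)%N; rewrite ?addn0// add1n [RHS]big_nat_recr.
Qed.

Lemma leq_sum_dvdn (F : nat -> nat) p N : (0 < p)%N ->
  (\sum_(1 <= u < N | p %| u) F (u %/ p) <= \sum_(1 <= w < N) F w)%N.
Proof.
move=> p0; case: N => [|n]; first by rewrite !big_geq.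
rewrite sum_dvdn// [leqRHS](@big_cat_nat _ _ _ (n %/ p).+1)//= ?leq_addr//.
by rewrite ltnS leq_div.
Qed.

Lemma in_region_mul a b T p u v : odd p ->
  in_region a b T (p * u) (p * v) = in_region a b (T / p%:R) u v.
Proof.
move=> op; have p0 : (0 : R) < p%:R by rewrite ltr0n; case: p op.
rewrite /in_region !oddM op/=; congr [&& _, _, _ & _].
  by rewrite natrM mulrA ler_pdivlMr// mulrC.
have -> : u%:R = (p * u)%N%:R / p%:R :> R by rewrite natrM mulrC mulKf// gt_eqF.
by rewrite height_div// mulrA ler_pdivlMr// -natrM [(v * p)%N]mulnC.
Qed.

(** A common prime factor of u and v is odd, as u and v are not both even. *)
Lemma region_count_sieve (a b : bool) T N : a || b ->
  (region_count a b T N <= coprime_region_count a b T N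
     + \sum_(1 <= p < N | odd p && prime p) region_count a b (T / p%:R) N)%N.
Proof.
move=> ab.
pose common p u v := [&& (p %| u)%N, (p %| v)%N & in_region a b T u v].
pose bad u v := (\sum_(1 <= p < N | odd p && prime p) common p u v)%N.
apply: (@leq_trans (\sum_(1 <= u < N) \sum_(1 <= v < N)
    ((in_region a b T u v && coprime u v) + bad u v)))%N.
  rewrite /region_count big_nat_cond [leqRHS]big_nat_cond.
  apply: leq_sum => u /andP[/andP[u0 uN] _]; apply: leq_sum => v _.
  case uv: (in_region a b T u v) => //=.
  have [//|ncuv] := boolP (coprime u v).
  have g1 : (1 < gcdn u v)%N.
    by rewrite ltn_neqAle eq_sym ncuv gcdn_gt0 u0.
  set p := pdiv (gcdn u v).
  have pp : prime p by apply: pdiv_prime.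
  have [pu pv] : (p %| u)%N /\ (p %| v)%N.
    by split; apply: dvdn_trans (pdiv_dvd _) _; rewrite ?dvdn_gcdl ?dvdn_gcdr.
  have op : odd p.
    have /and4P[/eqP ua /eqP vb _ _] := uv.
    by move: ab; rewrite -ua -vb => /orP[|]; apply: dvdn_odd.
  have pN : (p < N)%N by apply: leq_ltn_trans uN; apply: dvdn_leq.
  rewrite /bad big_mkcond (bigD1_seq p)/= ?iota_uniq ?op ?pp//; last first.
    by rewrite mem_index_iota prime_gt0.
  by rewrite /common pu pv uv.
rewrite (eq_bigr (fun u => \sum_(1 <= v < N) (in_region a b T u v && coprime u v)
    + \sum_(1 <= v < N) bad u v)%N); last by move=> u _; rewrite big_split.
rewrite big_split/= leq_add2l /bad.
under eq_bigr do rewrite exchange_big /=.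
rewrite exchange_big/=; apply: leq_sum => p /andP[op _].
have p0 : (0 < p)%N by case: p op.
rewrite /region_count.
pose G u := (\sum_(1 <= v < N) in_region a b (T / p%:R) u v)%N.
apply: leq_trans (leq_sum_dvdn G N p0).
rewrite [leqRHS]big_mkcond; apply: leq_sum => u _; rewrite /common.
case: (boolP (p %| u)%N) => pu /=; last by rewrite big1.
apply: leq_trans (leq_sum_dvdn (fun v => in_region a b (T / p%:R) (u %/ p) v : nat) N p0).
rewrite [leqRHS]big_mkcond; apply: leq_sum => v _.
case: (boolP (p %| v)%N) => pv //=.
by rewrite -in_region_mul// ![(p * _)%N]mulnC !divnK.
Qed.

(** With n = 2k + 1, this bounds 1/n^2 by 1/(n^2 - 1) written as a telescoping
difference. *)
Let inv_sqr_odd_le (k : R) : 0 < k ->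
  (2 * k + 1) ^- 2 <= (4 * k)^-1 - (4 * (k + 1))^-1.
Proof.
move=> k0; have k1 : 0 < k + 1 by lra.
have -> : (4 * k)^-1 - (4 * (k + 1))^-1 = (4 * (k * (k + 1)))^-1.
  by field; rewrite !gt_eqF.
rewrite lef_pV2 ?posrE; [nra|by rewrite exprn_gt0//; lra|].
by rewrite mulr_gt0// mulr_gt0.
Qed.

(** Primes below 29 are summed exactly; beyond, all odd numbers are kept and
their sum telescopes. Keeping all odd numbers from the start would give
pi^2/8 - 1 = 0.234, which is too large for the final constant. *)
Lemma sum_inv_sqr_odd_prime N :
  \sum_(1 <= p < N | odd p && prime p) (p%:R ^- 2 : R) <= 2118 / 10000.
Proof.
pose S n := \sum_(1 <= p < n | odd p && prime p) (p%:R ^- 2 : R).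
rewrite -/(S N).
have S0 m n : 0 <= \sum_(m <= p < n | odd p && prime p) (p%:R ^- 2 : R).
  by apply: sumr_ge0 => i _; rewrite invr_ge0 exprn_ge0.
have S29 : S 29%N <= 2118 / 10000 - (4 * 14%:R)^-1.
  rewrite /S unlock /=; lra.
(* The potential 1/(4 (n./2)) changes only at odd n. *)
have tail m : S (29 + m)%N <= 2118 / 10000 - (4 * ((29 + m)./2)%:R)^-1.
  elim: m => [|m]; first by rewrite addn0.
  clear S29; have : (0 < (29 + m)./2)%N by rewrite half_gt0.
  rewrite addnS; move: (29 + m)%N => n n0 IHn.
  have n1 : (1 <= n)%N by case: n n0 {IHn}.
  have k0 : (0 : R) < n./2%:R by rewrite ltr0n.
  have step : S n.+1 = S n + (if odd n && prime n then n%:R ^- 2 else 0).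
    by rewrite /S big_mkcond big_nat_recr//= -big_mkcond.
  rewrite step /= uphalf_half; case: (boolP (odd n)) => [on|_] /=; last first.
    by rewrite addr0 add0n.
  have nE : n%:R = 2 * n./2%:R + 1 :> R.
    by rewrite -[n in LHS]odd_double_half on -mul2n natrD natrM addrC.
  have := inv_sqr_odd_le k0; rewrite add1n -[n./2.+1%:R]natr1 -nE.
  have : 0 <= (n%:R ^- 2 : R) by rewrite invr_ge0 exprn_ge0.
  by case: (prime n) => /=; lra.
have [N29|N29] := leqP 29 N.
  rewrite -(subnKC N29); apply: le_trans (tail _) _.
  by rewrite lerBlDr lerDl invr_ge0 mulr_ge0.
apply: le_trans (_ : S 29%N <= _); last by apply: le_trans S29 _; lra.
case: N N29 => [|N] N29; first by rewrite /S big_geq.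
by rewrite /S [leRHS](@big_cat_nat _ _ _ N.+1) ?(ltnW N29)//= lerDl.
Qed.

(** Numerically, (256/625) * (0.9948 - 0.2118) > 0.3207. The slack pays for the
linear errors 170 T/p of the sieve. To avoid estimating the sum of 1/p, 170 y
with y = T/p is bounded by y^2/1000 + 170^2 * 1000/4; the first term is absorbed
by the main one and the second occurs at most 10 T times. *)
Lemma coprime_region_count_ge (a b : bool) T N : a || b -> 10 ^+ 12 <= T ->
  N = (Num.truncn (10 * T)).+1 ->
  3203 / 10000 * T ^+ 2 <= 4 * (coprime_region_count a b T N)%:R.
Proof.
move=> ab T12 NE.
have T20 : 20 <= T by apply: le_trans T12; lra.
have T0 : 0 < T by lra.
have T10 : 0 <= 10 * T by lra.
have /andP[NT TN] := truncn_itv T10.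
rewrite -NE in TN.
have := region_count_sieve T N ab.
rewrite -(ler_nat R) natrD natr_sum => H.
have := region_count_ge a b T20 TN.
have : 4 * \sum_(1 <= p < N | odd p && prime p)
          ((region_count a b (T / p%:R) N)%:R : R)
   <= (256 / 625 + 1 / 1000) * (2118 / 10000) * T ^+ 2 + 2500 * 2890 * (10 * T).
  apply: (@le_trans _ _ (\sum_(1 <= p < N | odd p && prime p)
      ((256 / 625 + 1 / 1000) * T ^+ 2 * p%:R ^- 2)
      + \sum_(1 <= p < N) (2500 * 2890))).
    rewrite mulr_sumr [X in _ <= X + _]big_mkcond [X in X <= _]big_mkcond -big_split/=.
    rewrite big_nat_cond [leRHS]big_nat_cond.
    apply: ler_sum => p /andP[/andP[p1 pN] _].
    case: ifP => _; last by lra.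
    have p0 : (0 : R) < p%:R by rewrite ltr0n.
    have Tp : 0 < T / p%:R by rewrite divr_gt0.
    apply: le_trans (region_count_le a b Tp _) _.
      apply: le_lt_trans TN; rewrite ler_pM2l// ler_pdivrMr// ler_peMr ?ler1n//.
      exact: ltW.
    rewrite -[X in _ <= X + _]mulrA -[T ^+ 2 / _]expr_div_n; move: (T / p%:R) => y.
    (* The square that gives 170 y <= y^2/1000 + 2500 * 2890. *)
    have := sqr_ge0 (y - 85 * 1000); lra.
  rewrite -mulr_sumr sumr_const_nat lerD//.
    have := sum_inv_sqr_odd_prime N.
    have := sqr_ge0 T.
    move: (\sum_(_ <= _ < _ | _) _) (T ^+ 2) => S t; nra.
  rewrite NE subn1/= -mulr_natr; lra.
have : 10 ^+ 12 * T <= T ^+ 2 by rewrite expr2 ler_pM2r.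
clear -H T0; lra.
Qed.
End Region.

(** * Parametrization of primitive Pythagorean triples *)

Section Triples.
Local Open Scope nat_scope.

Definition even_triple (p : nat * nat) : nat * nat * nat :=
  let: (u, v) := p in (u ^ 2 - v ^ 2, 2 * (u * v), u ^ 2 + v ^ 2).

Definition odd_triple (p : nat * nat) : nat * nat * nat :=
  let: (u, v) := p in ((u ^ 2 - v ^ 2)./2, u * v, (u ^ 2 + v ^ 2)./2).

Let coprime_mul_sqrD u v : coprime u v -> coprime (u * v) (u ^ 2 + v ^ 2).
Proof.
move=> uv; rewrite coprimeMl; apply/andP; split.
  by rewrite /coprime -mulnn gcdnMDl -/(coprime _ _) coprimeXr.
by rewrite /coprime addnC -mulnn gcdnMDl -/(coprime _ _) coprimeXr// coprime_sym.
Qed.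

Lemma even_triple_pythagorean u v : coprime u v -> odd u != odd v ->
    0 < u -> 0 < v -> 2 * (u * v) + v ^ 2 < u ^ 2 ->
  let: (a, b, c) := even_triple (u, v) in
  [/\ [/\ 0 < a, 0 < b & 0 < c], b < a, a ^ 2 + b ^ 2 = c ^ 2 & coprime b c].
Proof.
move=> cuv ouv u0 v0 h /=.
have vu : v ^ 2 <= u ^ 2 by lia.
have uE := subnK vu; move: (u ^ 2 - v ^ 2) uE => a uE.
split; [split; lia|lia| |].
  rewrite -uE !expnMn -uE; move: (v ^ 2) => w; nia.
rewrite coprimeMl coprime_mul_sqrD// andbT coprime2n oddD !oddX/=.
by move: ouv; case: (odd u); case: (odd v).
Qed.

Lemma odd_triple_pythagorean u v : coprime u v -> odd u -> odd v ->
    2 * (u * v) + v ^ 2 < u ^ 2 ->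
  let: (a, b, c) := odd_triple (u, v) in
  [/\ [/\ 0 < a, 0 < b & 0 < c], b < a, a ^ 2 + b ^ 2 = c ^ 2 & coprime b c].
Proof.
move=> cuv ou ov h /=.
have vu : v ^ 2 <= u ^ 2 by lia.
have aE : (u ^ 2 - v ^ 2)./2.*2 = u ^ 2 - v ^ 2.
  by rewrite -[RHS]odd_double_half oddB// !oddX ou ov.
have cE : (u ^ 2 + v ^ 2)./2.*2 = u ^ 2 + v ^ 2.
  by rewrite -[RHS]odd_double_half oddD !oddX ou ov.
have : coprime (u * v) ((u ^ 2 + v ^ 2)./2 * 2).
  by rewrite muln2 cE coprime_mul_sqrD.
rewrite coprimeMr => /andP[cop _].
move: aE cE cop; move: (_./2) (_./2) => c a aE cE cop.
have uE : u ^ 2 = v ^ 2 + a.*2 by lia.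
have u0 : 0 < u by case: u ou {cuv h vu aE cE cop uE}.
have v0 : 0 < v by case: v ov {cuv h vu aE cE cop uE}.
have uv0 : 0 < u * v by rewrite muln_gt0 u0.
split => //; [split; lia|lia|].
have -> : c = v ^ 2 + a by lia.
rewrite expnMn uE; move: (v ^ 2) => w; nia.
Qed.

(** Coprime factors of a square are squares; the square root of a factor is its
gcd with the root of the product. *)
Lemma coprime_sqr_root m n k : coprime m n -> m * n = k ^ 2 -> gcdn m k ^ 2 = m.
Proof.
have [->|k0] := posnP k.
  move=> mn /eqP; rewrite gcdn0 muln_eq0 => /orP[/eqP -> //|/eqP n0].
  by move: mn; rewrite n0 /coprime gcdn0 => /eqP ->.
move=> mn mnk; have m0 : 0 < m by case: m mnk {mn} => // /esym/eqP; rewrite expn_eq0 eqn0Ngt k0.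
set g := gcdn m k; apply/eqP; rewrite eqn_dvd; apply/andP; split.
  rewrite -(@Gauss_dvdl _ _ n) ?mnk ?dvdn_exp2r ?dvdn_gcdr//.
  by rewrite coprimeXl// (coprime_dvdl _ mn)// dvdn_gcdl.
have [m' mE] := dvdnP (dvdn_gcdl m k); have [k' kE] := dvdnP (dvdn_gcdr m k).
rewrite -/g in mE kE; have g0 : 0 < g by rewrite gcdn_gt0 m0.
have cmk : coprime m' k'.
  by rewrite /coprime -(eqn_pmul2r g0) muln_gcdl -mE -kE mul1n.
have : m' %| g * k' ^ 2.
  apply/dvdnP; exists n; apply/eqP; rewrite -(eqn_pmul2r g0).
  by apply/eqP; rewrite -[RHS]mulnA -mE [RHS]mulnC mnk kE; ring.
rewrite Gauss_dvdl ?coprimeXr// => m'g.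
by rewrite {1}mE -mulnn dvdn_mul.
Qed.

(** Factor b^2 = (c + a)(c - a). For odd b the two factors are coprime; for even b
their halves are, with product (b/2)^2. Either way both are squares, of u and v.
A common divisor of the factors divides b^2 and c. *)
Lemma pythagorean_param a b c : 0 < a -> 0 < b -> a ^ 2 + b ^ 2 = c ^ 2 ->
    coprime b c ->
  exists u v, [/\ 0 < v, v < u
    & (a, b, c) = even_triple (u, v) \/ (a, b, c) = odd_triple (u, v)].
Proof.
move=> a0 b0 abc cbc.
have ac : a < c by rewrite -ltn_sqr -abc; lia.
have [ob|eb] := boolP (odd b).
  have mn : (c + a) * (c - a) = b ^ 2 by rewrite mulnC -subn_sqr; lia.
  have cop : coprime (c + a) (c - a).
    set d := gcdn (c + a) (c - a); rewrite /coprime -/d.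
    have db : d %| b ^ 2 by rewrite -mn dvdn_mulr// dvdn_gcdl.
    have dc : d %| c * 2.
      have -> : c * 2 = (c + a) + (c - a) by lia.
      by rewrite dvdn_add// ?dvdn_gcdl ?dvdn_gcdr.
    rewrite Gauss_dvdl in dc; last by rewrite coprimen2 (dvdn_odd db)// oddX.
    have : d %| gcdn (b ^ 2) c by rewrite dvdn_gcd db dc.
    by rewrite (eqP (coprimeXl 2 cbc)) dvdn1.
  have cop' : coprime (c - a) (c + a) by rewrite coprime_sym.
  have nm : (c - a) * (c + a) = b ^ 2 by rewrite mulnC.
  have := coprime_sqr_root cop mn; have := coprime_sqr_root cop' nm.
  move: (gcdn _ b) (gcdn _ b) => u v vE uE.
  exists u, v; split.
  - by rewrite -(ltn_sqr 0) vE; lia.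
  - by rewrite -ltn_sqr vE uE; lia.
  right; rewrite /odd_triple uE vE; congr (_, _, _).
  - have -> : c + a - (c - a) = a.*2 by lia.
    by rewrite doubleK.
  - by apply/eqP; rewrite -eqn_sqr expnMn uE vE mn.
  - have -> : c + a + (c - a) = c.*2 by lia.
    by rewrite doubleK.
have oc : odd c.
  apply: contraLR cbc => ec; apply/negP => /eqP g1.
  by have : 2 %| gcdn b c; [rewrite dvdn_gcd !dvdn2 eb ec|rewrite g1].
have oa : odd a.
  by have := congr1 odd abc; rewrite oddD !oddX/= (negbTE eb) oc addbF.
have aE := odd_double_half a; have cE := odd_double_half c; have bE := odd_double_half b.
rewrite oa in aE; rewrite oc in cE; rewrite (negbTE eb) add0n in bE.
(* As a and c are odd, m = (c + a)/2 and n = (c - a)/2. *)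
pose m := (c./2 + a./2).+1; pose n := c./2 - a./2.
have mnc : m + n = c by rewrite /m /n; lia.
have mna : m = n + a by rewrite /m /n; lia.
have mn : m * n = b./2 ^ 2 by move: abc; rewrite -bE -mnc mna; nia.
have cop : coprime m n.
  set d := gcdn m n; rewrite /coprime -/d.
  have db : d %| b ^ 2 by rewrite -bE -muln2 expnMn -mn dvdn_mulr// dvdn_mulr// dvdn_gcdl.
  have dc : d %| c by rewrite -mnc dvdn_add// ?dvdn_gcdl ?dvdn_gcdr.
  have : d %| gcdn (b ^ 2) c by rewrite dvdn_gcd db dc.
  by rewrite (eqP (coprimeXl 2 cbc)) dvdn1.
have cop' : coprime n m by rewrite coprime_sym.
have nm : n * m = b./2 ^ 2 by rewrite mulnC.
have := coprime_sqr_root cop mn; have := coprime_sqr_root cop' nm.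
move: (gcdn _ b./2) (gcdn _ b./2) => u v vE uE.
exists u, v; split.
- by rewrite -(ltn_sqr 0) vE /n; lia.
- by rewrite -ltn_sqr vE uE; lia.
left; rewrite /even_triple uE vE; congr (_, _, _).
- by lia.
- rewrite -{1}bE -mul2n; congr (_ * _); apply/eqP.
  by rewrite -eqn_sqr expnMn uE vE mn.
- by lia.
Qed.

End Triples.

(** * The lower bound *)

Section Lists.
Local Open Scope nat_scope.

Definition grid N (P : nat -> nat -> bool) : seq (nat * nat) :=
  [seq p <- [seq (u, v) | u <- index_iota 1 N, v <- index_iota 1 N] | P p.1 p.2].

Lemma size_grid N P :
  size (grid N P) = \sum_(1 <= u < N) \sum_(1 <= v < N) P u v.
Proof.
rewrite size_filter -sum1_count big_mkcond big_allpairs_dep/=.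
by apply: eq_bigr => u _; apply: eq_bigr => v _; case: (P u v).
Qed.

Lemma uniq_grid N P : uniq (grid N P).
Proof.
by rewrite filter_uniq// allpairs_uniq ?iota_uniq// => -[u v] [u' v'] _ _ [-> ->].
Qed.

Lemma mem_grid N P u v : ((u, v) \in grid N P) =
  [&& P u v, 0 < u < N & 0 < v < N].
Proof.
rewrite mem_filter/= -!mem_index_iota; congr (_ && _).
apply/allpairsP/andP => [[[u' v'] [? ? [-> ->]]] //|[? ?]].
by exists (u, v).
Qed.

End Lists.

Section Counting.
Variable R : realType.
Implicit Types x T : R.

Lemma size_le_g x (t : seq (nat * nat * nat)) : uniq t ->
  (forall y, y \in t -> primitive_triangles x y) -> (size t <= g x)%N.
Proof.
move=> ut tx; apply: uniq_leq_size => // y /tx xy.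
by rewrite in_fset_set; [rewrite inE|exact: finite_primitive_triangles].
Qed.

Lemma g_le_size x (t : seq (nat * nat * nat)) :
  (forall y, primitive_triangles x y -> y \in t) -> (g x <= size t)%N.
Proof.
move=> xt; apply: (@leq_trans #|` [fset y in t]%fset|).
  apply: fsubset_leq_card; apply/fsubsetP => y.
  rewrite in_fset_set; last exact: finite_primitive_triangles.
  by rewrite inE => /xt; rewrite inE.
by rewrite card_fseq size_undup.
Qed.

Lemma in_region_bounds (a b : bool) T u v : 0 < T -> in_region a b T u v ->
  (0 < u)%N -> [/\ odd u = a, odd v = b, (625 * v <= 256 * u)%N
    & (u%:R ^+ 3 * v%:R <= 256 / 625 * T ^+ 4 :> R)].
Proof.
move=> T0 /and4P[/eqP-> /eqP-> uT vh] u0.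
have u0' : (0 : R) < u%:R by rewrite ltr0n.
split => //.
  rewrite -(ler_nat R) !natrM; have := height_le_id u%:R T0; lra.
have := height_expr3 T0 u0'.
have : 0 < u%:R ^+ 3 :> R by rewrite exprn_gt0.
move: (height T u%:R) (u%:R ^+ 3) (T ^+ 4) vh => h U t; nra.
Qed.

(** With v <= 256/625 u, and 256/625 < sqrt 2 - 1, the leg 2uv is the
smaller one. *)
Lemma even_triple_triangle x T a b u v : 256 / 625 * T ^+ 4 = x -> 0 < T ->
  a != b -> (0 < u)%N -> (0 < v)%N -> in_region a b T u v -> coprime u v ->
  primitive_triangles x (even_triple (u, v)).
Proof.
move=> Tx T0 ab u0 v0 /(in_region_bounds T0) -/(_ u0) [ou ov uv u3v] cuv.
have h : (2 * (u * v) + v ^ 2 < u ^ 2)%N by nia.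
have := even_triple_pythagorean cuv; rewrite ou ov => /(_ ab u0 v0 h).
rewrite /primitive_triangles /= => -[? ? ? ?]; split => //.
apply: lt_le_trans (_ : u%:R ^+ 3 * v%:R <= x); last by rewrite -Tx.
rewrite natrM natrB; last by lia.
rewrite !natrX !natrM ltr_pdivrMr//.
have u0' : (0 : R) < u%:R by rewrite ltr0n.
have v0' : (0 : R) < v%:R by rewrite ltr0n.
rewrite -subr_gt0; set d := (X in 0 < X).
have -> : d = 2 * (u%:R * v%:R ^+ 3) by rewrite /d; ring.
by rewrite !mulr_gt0// exprn_gt0.
Qed.

Lemma odd_triple_triangle x T u v : 256 / 625 * T ^+ 4 = 4 * x -> 0 < T ->
  (0 < u)%N -> (0 < v)%N -> in_region true true T u v -> coprime u v ->
  primitive_triangles x (odd_triple (u, v)).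
Proof.
move=> Tx T0 u0 v0 /(in_region_bounds T0) -/(_ u0) [ou ov uv u3v] cuv.
have h : (2 * (u * v) + v ^ 2 < u ^ 2)%N by nia.
have := odd_triple_pythagorean cuv ou ov h.
rewrite /primitive_triangles /= => -[? ? ? ?]; split => //.
have aE : (2 * (u ^ 2 - v ^ 2)./2 + v ^ 2 = u ^ 2)%N.
  have := odd_double_half (u ^ 2 - v ^ 2); rewrite oddB ?oddX ?ou ?ov/=; lia.
move: (_./2) aE => q /(congr1 (fun n => n%:R : R)).
rewrite natrD !natrX !natrM => aE.
have u0' : (0 : R) < u%:R by rewrite ltr0n.
have v0' : (0 : R) < v%:R by rewrite ltr0n.
have : 0 < u%:R * v%:R ^+ 3 :> R by rewrite mulr_gt0// exprn_gt0.
have -> : q%:R = (u%:R ^+ 2 - v%:R ^+ 2) / 2 :> R by rewrite -aE; field.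
rewrite Tx in u3v; move: u3v.
move: (u%:R : R) (v%:R : R) => U V u3v V3.
have -> : (U ^+ 2 - V ^+ 2) / 2 * (U * V) / 2 = (U ^+ 3 * V - U * V ^+ 3) / 4.
  by field.
lra.
Qed.

Lemma even_triple_neq_odd_triple u v u' v' : odd u -> odd v -> even_triple (u', v') <> odd_triple (u, v).
Proof.
move=> ou ov [_ bE _].
by have := congr1 odd bE; rewrite !oddM ou ov.
Qed.

Lemma even_triple_inj u v u' v' : (v < u)%N -> (v' < u')%N ->
  even_triple (u, v) = even_triple (u', v') -> (u, v) = (u', v').
Proof.
move=> vu vu' [aE _ cE].
rewrite -ltn_sqr in vu; rewrite -ltn_sqr in vu'.
have uE : (u ^ 2 = u' ^ 2)%N by lia.
have vE : (v ^ 2 = v' ^ 2)%N by lia.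
have uu : u = u' by apply/eqP; rewrite -eqn_sqr uE.
have vv : v = v' by apply/eqP; rewrite -eqn_sqr vE.
by rewrite uu vv.
Qed.

Lemma odd_triple_inj u v u' v' : (v < u)%N -> (v' < u')%N ->
  odd u -> odd v -> odd u' -> odd v' ->
  odd_triple (u, v) = odd_triple (u', v') -> (u, v) = (u', v').
Proof.
move=> vu vu' ou ov ou' ov' [aE _ cE].
rewrite -ltn_sqr in vu; rewrite -ltn_sqr in vu'.
have := odd_double_half (u ^ 2 - v ^ 2); have := odd_double_half (u' ^ 2 - v' ^ 2).
have := odd_double_half (u ^ 2 + v ^ 2); have := odd_double_half (u' ^ 2 + v' ^ 2).
rewrite aE cE !oddD !oddB ?(ltnW vu) ?(ltnW vu')// !oddX ou ov ou' ov'/= => cu cu' au au'.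
have uE : (u ^ 2 = u' ^ 2)%N by lia.
have vE : (v ^ 2 = v' ^ 2)%N by lia.
have uu : u = u' by apply/eqP; rewrite -eqn_sqr uE.
have vv : v = v' by apply/eqP; rewrite -eqn_sqr vE.
by rewrite uu vv.
Qed.

(** The two triangle forms give different triples, because b = 2uv is even in
the first and b = uv is odd in the second. *)
Lemma g_ge_coprime_region x T N N' : 256 / 625 * T ^+ 4 = x -> 0 < T ->
  (coprime_region_count false true T N + coprime_region_count true false T N
   + coprime_region_count true true (Num.sqrt 2 * T) N' <= g x)%N.
Proof.
move=> Tx T0.
set T' := Num.sqrt 2 * T.
have s0 : 0 < Num.sqrt 2 :> R by rewrite sqrtr_gt0.
have T'0 : 0 < T' by rewrite mulr_gt0.
have Tx' : 256 / 625 * T' ^+ 4 = 4 * x.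
  have : Num.sqrt 2 ^+ 2 = 2 :> R by rewrite sqr_sqrtr.
  rewrite -Tx /T' exprMn => s2.
  have -> : Num.sqrt 2 ^+ 4 = 4 :> R by rewrite (exprM _ 2 2) s2; ring.
  by ring.
rewrite /coprime_region_count -!size_grid.
set s01 := grid _ _; set s10 := grid _ _; set s11 := grid _ _.
have in01 u v : (u, v) \in s01 -> [/\ in_region false true T u v, coprime u v, (0 < u)%N & (0 < v)%N].
  by rewrite mem_grid => /and3P[/andP[? ?] /andP[? _] /andP[? _]].
have in10 u v : (u, v) \in s10 -> [/\ in_region true false T u v, coprime u v, (0 < u)%N & (0 < v)%N].
  by rewrite mem_grid => /and3P[/andP[? ?] /andP[? _] /andP[? _]].
have in11 u v : (u, v) \in s11 -> [/\ in_region true true T' u v, coprime u v, (0 < u)%N & (0 < v)%N].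
  by rewrite mem_grid => /and3P[/andP[? ?] /andP[? _] /andP[? _]].
have even_lt u v : (u, v) \in s01 ++ s10 -> (v < u)%N.
  by rewrite mem_cat => /orP[/in01|/in10] [/(in_region_bounds T0) + _ u0 v0];
    move=> /(_ u0) [_ _ ? _]; lia.
have odd_lt u v : (u, v) \in s11 -> [/\ (v < u)%N, odd u & odd v].
  by move=> /in11 [/(in_region_bounds T'0) + _ u0 v0];
    move=> /(_ u0) [? ? ? _]; split => //; lia.
rewrite -size_cat -(size_map even_triple) -(size_map odd_triple s11) -size_cat.
apply: size_le_g.
  rewrite cat_uniq; apply/and3P; split.
  - rewrite map_inj_in_uniq; last first.
      by move=> [u v] [u' v'] /even_lt ? /even_lt ?; apply: even_triple_inj.
    rewrite cat_uniq !uniq_grid andbT/=; apply/hasPn => -[u v] /in10 [p10 _ u0 _].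
    apply/negP => /in01 [p01 _ _ _].
    have [ou _ _ _] := in_region_bounds T0 p10 u0.
    by have [] := in_region_bounds T0 p01 u0; rewrite ou.
  - apply/hasPn => _ /mapP[[u v] /odd_lt[_ ou ov] ->].
    apply/negP => /mapP[[u' v'] _] /esym; exact: even_triple_neq_odd_triple.
  - rewrite map_inj_in_uniq ?uniq_grid//.
    by move=> [u v] [u' v'] /odd_lt[? ? ?] /odd_lt[? ? ?]; apply: odd_triple_inj.
move=> y; rewrite mem_cat => /orP[] /mapP[[u v]].
  rewrite mem_cat => /orP[/in01|/in10] [uvT cuv u0 v0] ->.
    exact: (even_triple_triangle Tx T0 _ u0 v0 uvT).
  exact: (even_triple_triangle Tx T0 _ u0 v0 uvT).
by move=> /in11[uvT cuv u0 v0] ->; apply: (odd_triple_triangle Tx' T'0 u0 v0 uvT).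
Qed.

Lemma g_ge_sqrt x : (256 / 625) * (10 ^+ 12) ^+ 4 <= x -> Num.sqrt x / 2 <= (g x)%:R.
Proof.
move=> xT; have x0 : 0 < x by apply: lt_le_trans xT; lra.
pose T := 5 / 4 * Num.sqrt (Num.sqrt x).
have T2 : T ^+ 2 = 25 / 16 * Num.sqrt x.
  by rewrite exprMn sqr_sqrtr ?sqrtr_ge0//; field.
have Tx : 256 / 625 * T ^+ 4 = x.
  rewrite (exprM _ 2 2) T2 exprMn sqr_sqrtr; last exact: ltW.
  by field.
have s0 : 0 < Num.sqrt x by rewrite sqrtr_gt0.
have T0 : 0 < T by rewrite mulr_gt0// sqrtr_gt0.
have T12 : 10 ^+ 12 <= T.
  have c0 : (0 : R) < 256 / 625 by lra.
  have := xT; rewrite -Tx (ler_pM2l c0) ler_pXn2r// nnegrE; last exact: ltW.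
  by rewrite exprn_ge0.
have s1 : (1 : R) <= Num.sqrt 2 by rewrite -[leLHS]sqrtr1 ler_sqrt// ler1n.
have s2 : Num.sqrt 2 ^+ 2 = 2 :> R by rewrite sqr_sqrtr.
have T12' : 10 ^+ 12 <= Num.sqrt 2 * T by apply: (le_trans T12); rewrite ler_peMl// ltW.
have := g_ge_coprime_region _ _ Tx T0.
move=> /(_ (Num.truncn (10 * T)).+1 (Num.truncn (10 * (Num.sqrt 2 * T))).+1).
rewrite -(ler_nat R) !natrD.
have := @coprime_region_count_ge R false true T _ isT T12 erefl.
have := @coprime_region_count_ge R true false T _ isT T12 erefl.
have := @coprime_region_count_ge R true true _ _ isT T12' erefl.
rewrite exprMn s2 T2; lra.
Qed.
End Counting.

(** * The upper bound *)

Section Cusp.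
Variable R : realType.
Implicit Types x T : R.

(** Beyond T + 1 the height decreases, so the sum is below the integral with
no error term; a bounded error in each column would be too much here, as
nothing cuts the cusp. *)
Lemma sum_height_le T n : 0 < T ->
  \sum_(1 <= u < n.+1) height T u%:R <=
  if n%:R <= T + 1 then T * n%:R else T * (T + 1) + heightint T n%:R.
Proof.
move=> T0; elim: n => [|n IHn]; first by rewrite big_geq// ler_wpDl ?mulr0//; lra.
rewrite big_nat_recr//=.
have hT := height_le n.+1%:R T0; move: hT IHn.
rewrite -natr1; set S := \sum_(_ <= _ < _) _ => hT.
case: (leP (n%:R + 1) (T + 1)) => nT; first by rewrite ifT; [lra|lra].
have step : height T (n%:R + 1) <= heightint T (n%:R + 1) - heightint T n%:R.
  rewrite /height /heightint.
  have -> : (n%:R + 1 <= T) = false by apply/negbTE; rewrite -ltNge; lra.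
  have -> : (n%:R <= T) = false by apply/negbTE; rewrite -ltNge; lra.
  have := @heightint_tail R T n%:R (n%:R + 1) T0; lra.
case: (leP n%:R (T + 1)) => nT1; last lra.
have n0 : 0 <= n%:R :> R by [].
have : 0 <= heightint T n%:R.
  rewrite /heightint; case: ifP => _; first by rewrite divr_ge0// sqr_ge0.
  rewrite subr_ge0 ler_pdivrMr; last by rewrite mulr_gt0// exprn_gt0//; lra.
  have : T ^+ 2 <= n%:R ^+ 2 by rewrite lerXn2r ?nnegrE//; lra.
  have := sqr_ge0 T; have -> : T ^+ 4 = T ^+ 2 * T ^+ 2 by ring.
  nra.
have : T * n%:R <= T * (T + 1) by rewrite ler_pM2l.
lra.
Qed.

Lemma count_le (w : R) N : 0 <= w ->
  (\sum_(1 <= v < N) (v%:R <= w)%R)%N%:R <= w.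
Proof.
move=> w0; have /andP[tw wt] := truncn_itv w0; apply: le_trans tw.
rewrite ler_nat; move: (Num.truncn w) wt => m wm.
apply: (@leq_trans (\sum_(1 <= v < N) (v <= m)))%N.
  apply: leq_sum => v _; case: (leqP v m) => [_|mv]; first by case: (_ <= w).
  by rewrite leNgt (lt_le_trans wm)// ler_nat.
have : (\sum_(1 <= v < N) (v <= m) <= minn m N.-1)%N.
  case: N => [|N]; first by rewrite big_geq.
  elim: N => [|N IHN]; first by rewrite big_geq.
  by rewrite big_nat_recr//=; move: IHN => /=; case: (leqP N.+1 m) => /=; lia.
by move=> /leq_trans; apply; apply: geq_minl.
Qed.

Definition in_cusp T (u v : nat) : bool :=
  (v < u)%N && (u%:R ^+ 3 * v%:R <= T ^+ 4).

Lemma cusp_count_le T N : 1 <= T ->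
  (\sum_(1 <= u < N) \sum_(1 <= v < N) in_cusp T u v)%N%:R <= 3 * T ^+ 2.
Proof.
move=> T1; have T0 : 0 < T by lra.
apply: (@le_trans _ _ (\sum_(1 <= u < N) height T u%:R)).
  rewrite natr_sum big_nat_cond [leRHS]big_nat_cond.
  apply: ler_sum => u /andP[/andP[u0 _] _].
  have u0' : (0 : R) < u%:R by rewrite ltr0n.
  apply: le_trans (count_le N (height_ge0 T0 (ltW u0'))).
  rewrite ler_nat; apply: leq_sum => v _.
  rewrite /in_cusp; case: ltnP => //= vu; case: leP => //= uvT.
  rewrite /height; case: ifP => _; first by rewrite ler_nat (ltnW vu).
  by rewrite ler_pdivlMr ?exprn_gt0// mulrC uvT.
case: N => [|n]; first by rewrite big_geq// mulr_ge0// sqr_ge0.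
apply: le_trans (sum_height_le n T0) _.
have := heightint_le T0 (ler0n R n).
have : T <= T ^+ 2 by rewrite expr2 ler_peMl// ltW.
case: (leP n%:R (T + 1)) => nT; last by lra.
have : T * n%:R <= T * (T + 1) by rewrite ler_pM2l.
lra.
Qed.

(** From b < a one gets v <= u/2, hence u^2 - v^2 >= 3/4 u^2 and the area
controls u^3 v. *)
Lemma g_le_sqrt x : 1 <= x -> (g x)%:R <= 24 * Num.sqrt x.
Proof.
move=> x1; have x0 : 0 < x by lra.
have s1 : 1 <= Num.sqrt x by rewrite -[leLHS]sqrtr1; apply: ler_wsqrtr.
pose T := 2 * Num.sqrt (Num.sqrt x).
have T2 : T ^+ 2 = 4 * Num.sqrt x.
  by rewrite exprMn sqr_sqrtr ?sqrtr_ge0//; ring.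
have T4 : T ^+ 4 = 16 * x.
  rewrite (exprM _ 2 2) T2 exprMn sqr_sqrtr; last exact: ltW.
  by ring.
have T1 : 1 <= T.
  have : 1 <= Num.sqrt (Num.sqrt x) by rewrite -[leLHS]sqrtr1; apply: ler_wsqrtr.
  rewrite /T; lra.
pose N := (Num.truncn (16 * x)).+1.
have xN : 16 * x < N%:R.
  have x16 : 0 <= 16 * x by lra.
  by have /andP[_] := truncn_itv x16.
have cuspN u v : (0 < v)%N -> (v < u)%N -> u%:R ^+ 3 * v%:R <= T ^+ 4 ->
    (u, v) \in grid N (in_cusp T).
  move=> v0 vu uvT; have u0 : (0 < u)%N by lia.
  have uN : (u < N)%N.
    rewrite -(ltr_nat R); apply: le_lt_trans xN; rewrite -T4; apply: le_trans uvT.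
    rewrite -natrX -natrM ler_nat; apply: (@leq_trans (u ^ 3)); last exact: leq_pmulr.
    by rewrite -{1}(expn1 u) leq_pexp2l.
  by rewrite mem_grid /in_cusp vu uvT v0 u0 uN (ltn_trans vu uN).
have := cusp_count_le N T1; rewrite -size_grid T2 => sz.
suff : (g x <= size (map even_triple (grid N (in_cusp T))
                 ++ map odd_triple (grid N (in_cusp T))))%N.
  by rewrite size_cat !size_map -(ler_nat R) natrD; lra.
apply: g_le_size => -[[a b] c] [[a0 b0 _] ba abc cbc abx].
have [u [v [v0 vu abcE]]] := pythagorean_param a0 b0 abc cbc.
rewrite mem_cat.
have u0' : (0 : R) < u%:R by rewrite ltr0n; lia.
have v0' : (0 : R) < v%:R by rewrite ltr0n.
(* The factor 6 covers both forms: uv(u^2 - v^2) is the area in the first, and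
at most 3ab, six times the area, in the second, where (u^2 - v^2)./2 could round
down. *)
have key : (2 * v <= u)%N -> u%:R * v%:R * (u%:R ^+ 2 - v%:R ^+ 2) <= 6 * x ->
    (u, v) \in grid N (in_cusp T).
  move=> v2u; rewrite -(ler_nat R) natrM in v2u => uvx; apply: cuspN => //; rewrite T4.
  have : (2 * v%:R) ^+ 2 <= u%:R ^+ 2 :> R by rewrite lerXn2r ?nnegrE//; lra.
  move: (u%:R : R) (v%:R : R) u0' v0' uvx {v2u} => U V U0 V0 uvx V2.
  have UV : 0 < U * V by rewrite mulr_gt0.
  have : U * V * (3 / 4 * U ^+ 2) <= U * V * (U ^+ 2 - V ^+ 2).
    by rewrite ler_pM2l//; rewrite exprMn in V2; lra.
  have -> : U * V * (3 / 4 * U ^+ 2) = 3 / 4 * (U ^+ 3 * V) by ring.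
  lra.
have vu2 : (v ^ 2 <= u ^ 2)%N by rewrite leq_sqr ltnW.
case: abcE => abcE; rewrite abcE; apply/orP; [left|right]; apply: map_f; apply: key.
- case: abcE => aE bE _; rewrite leqNgt; apply/negP => u2v; nia.
- case: abcE abx => -> -> _; rewrite ltr_pdivrMr// natrM natrB// !natrX !natrM.
  by set X := (X in X < _); have -> : X = 2 * (u%:R * v%:R * (u%:R ^+ 2 - v%:R ^+ 2)); [rewrite /X; ring|lra].
- case: abcE => aE bE _; rewrite leqNgt; apply/negP => u2v.
  have : (2 * a <= u ^ 2 - v ^ 2)%N by rewrite aE; lia.
  nia.
- case: abcE => aE bE _.
  have a3 : (u ^ 2 - v ^ 2 <= 3 * a)%N by rewrite aE in a0 *; lia.
  move: a3 abx; rewrite -(ler_nat R) natrB// !natrX natrM ltr_pdivrMr//.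
  rewrite bE !natrM => a3 abx.
  have uv0 : 0 < u%:R * v%:R :> R by rewrite mulr_gt0.
  by move: a3; rewrite -(ler_pM2l uv0); lra.
Qed.

End Cusp.

Theorem proposition1p4 (R : realType) :
  exists2 C : R, 0 < C &
    \forall x \near +oo,
      Num.sqrt x / 2 - C < (g x)%:R /\
      (g x)%:R <= (2 * 4 `^ (1 / 3))^-1 * x `^ (2 / 3) + C * x `^ (5 / 9).
Proof.
exists 24 => //; near=> x.
have x1 : 1 <= x by near: x; apply: nbhs_pinfty_ge; rewrite num_real.
split.
  apply: lt_le_trans (_ : Num.sqrt x / 2 <= _); first by rewrite ltrBlDr ltrDl.
  by apply: g_ge_sqrt; near: x; apply: nbhs_pinfty_ge; rewrite num_real.
apply: le_trans (g_le_sqrt x1) _.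
apply: ler_wpDl; first by rewrite mulr_ge0 ?invr_ge0 ?mulr_ge0 ?powR_ge0.
rewrite ler_pM2l// -powR12_sqrt; last by apply: le_trans x1.
by apply: ler_powR => //; lra.
Unshelve. all: by end_near.
Qed.
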